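(* Let $v\in L^2(0,1)$ and let $f:[0,1]\times\mathbb{R}\to\mathbb{R}$ satisfy: (C(c)) $f$ is continuous on $[0,1]\times\mathbb{R}$ and has a continuous partial derivative $f_x$ with respect to the second variable on $[0,1]\times\mathbb{R}$; (C(f)) there exist positive constants $A,B$ with $A<\pi^2$ such that $|f(t,x)|\leqslant A|x|+B$ for all $t\in[0,1]$, $x\in\mathbb{R}$; (C($f_x$)) $\inf_{(t,x)\in[0,1]\times\mathbb{R}} f_x(t,x)>-\pi^2$. Then the Dirichlet problem $\ddot{x}(t)=f(t,x(t))+v(t)$ for a.e. $t\in[0,1]$, $x(0)=x(1)=0$, has a unique solution $x\in \mathbb{X}=H^2(0,1)\cap H^1_0(0,1)$.
   Context: $H^1_0(0,1)$ is the space of absolutely continuous $x:[0,1]\to\mathbb{R}$ with $x(0)=x(1)=0$ and weak derivative in $L^2(0,1)$; $H^2(0,1)$ is the space of functions in $H^1(0,1)$ whose derivative $\dot x$ also lies in $H^1(0,1)$. Solutions are understood in $\mathbb{X}=H^2(0,1)\cap H^1_0(0,1)$, the equation holding almost everywhere. *)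

(* Defs.v *)
From HB Require Import structures.
From mathcomp Require Import all_boot all_order all_algebra.
From mathcomp Require Import all_classical all_reals all_analysis.
Set Implicit Arguments. Unset Strict Implicit. Unset Printing Implicit Defensive.
Import Order.TTheory GRing.Theory Num.Theory.
Import numFieldNormedType.Exports.
Local Open Scope classical_set_scope.
Local Open Scope ring_scope.

Section Defs.
Variable R : realType.
Local Notation leb := (@lebesgue_measure R).

Definition L2_01 (g : R -> R) : Prop :=
  measurable_fun `[(0:R), 1] g /\
  leb.-integrable `[(0:R), 1] (fun t => ((g t) ^+ 2)%:E).

(* x is in H^1(0,1) with (weak) derivative dx: x is absolutely continuous on
   [0,1], i.e. x t = x 0 + int_0^t dx, and x, dx lie in L^2(0,1). *)
Definition H1_01 (x dx : R -> R) : Prop :=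
  L2_01 x /\ L2_01 dx /\
  forall t, 0 <= t <= 1 -> x t = x 0 + \int[leb]_(s in `[(0:R), t]) dx s.

Definition dirichlet_solution (f : R -> R -> R) (v : R -> R) (x : R -> R) : Prop :=
  exists dx ddx : R -> R,
    [/\ x 0 = 0, x 1 = 0, H1_01 x dx, H1_01 dx ddx &
        {ae leb, forall t, t \in `[(0:R), 1] -> ddx t = f t (x t) + v t}].

End Defs.

(* Main.v *)
Require Import Defs.
From HB Require Import structures.
From mathcomp Require Import all_boot all_order all_algebra.
From mathcomp Require Import all_classical all_reals all_analysis.
From mathcomp Require Import measurable_realfun ring lra.
Import Order.TTheory GRing.Theory Num.Theory.
Import numFieldNormedType.Exports.
Local Open Scope classical_set_scope.
Local Open Scope ring_scope.

(* Let W satisfy W'' = v and W(0) = W(1) = 0; then u = x - W is a classical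
   solution of u'' = f(t, u + W).  Everything rests on a maximum principle: for
   0 < l < pi the weight w(t) = cos(l (t - 1/2)) is positive on [0, 1] and
   w'' = - l^2 w, so that if z <= 0 at the end points and z'' > - l^2 z wherever
   z > K w, then z <= K w.  Take l with l^2 > A and - l^2 < inf f_x.
   Uniqueness: apply this with K = 0 to the difference of two solutions.
   A priori bound: the growth condition gives |x| <= K for some K, also for the
   equation with f(t, x) replaced by its truncation F(t, x) = f(t, x clamped to
   [-K, K]), which is therefore enough to solve.
   Existence: the difference quotients of F in x lie in some [m, M] with
   m > - l^2, and mapping u to the solution y of - y'' + M y = M u - F(t, u + W)
   is a contraction, of ratio (M - m) / (M + l^2), for the sup norm weighted by w. *)

(** * Clamping to an interval, used to extend functions from [[0, 1]] and to truncate *)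

Section Clamp.
Context {R : realType}.
Implicit Types a b t : R.

Definition clamp a b t : R := Num.min b (Num.max a t).

Lemma clamp_continuous a b : continuous (clamp a b).
Proof.
move=> t; apply: (@continuous_min R R (fun=> b) (Num.max a)); first exact: cvg_cst.
by apply: (@continuous_max R R (fun=> a) id); [exact: cvg_cst|exact: cvg_id].
Qed.

Lemma clamp_id a b t : a <= t <= b -> clamp a b t = t.
Proof. by move=> /andP[at_ tb]; rewrite /clamp (max_r at_) (min_r tb). Qed.

Lemma clamp_itv a b t : a <= b -> a <= clamp a b t <= b.
Proof. by move=> ab; rewrite /clamp le_min ab le_max lexx ge_min lexx. Qed.

Lemma clamp_sub a b s t : s <= t -> 0 <= clamp a b t - clamp a b s <= t - s.
Proof.
rewrite /clamp => st.
by case: (lerP a s); case: (lerP a t); case: (lerP b s); case: (lerP b t);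
  case: (lerP b a); lra.
Qed.

(** Since [phi] never leaves [A], the relative neighbourhoods in [A] are all that is tested. With
    [phi] built from clamps, data on [[0, 1]] become continuous on the whole line. *)
Lemma within_continuous_in (T U V : topologicalType) (A : set U) (F : U -> V)
    (phi : T -> U) :
  {within A, continuous F} -> continuous phi -> (forall z, A (phi z)) ->
  continuous (F \o phi).
Proof.
move=> /subspace_continuousP cF cphi Aphi z.
apply: cvg_trans (cF _ (Aphi z)); apply: cvg_comp; last exact: cvg_id.
move=> B AB; have := cphi z _ AB.
by apply: (@filterS _ (nbhs z)) => s /(_ (Aphi s)).
Qed.

Lemma within_continuous_clamp a b (g : R -> R) : a <= b ->
  {within `[a, b], continuous g} -> continuous (g \o clamp a b).
Proof.
move=> ab cg; apply: within_continuous_in cg (@clamp_continuous a b) _ => t.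
by rewrite /= in_itv/= clamp_itv.
Qed.

End Clamp.

(** * The cosine weight and the maximum principle *)

Section Comparison.
Context {R : realType}.
Implicit Types l K t : R.

Definition weight l t : R := cos (l * (t - 2^-1)).

Lemma is_derive_weight l t :
  is_derive t 1 (weight l) (- (l * sin (l * (t - 2^-1)))).
Proof.
rewrite /weight.
have -> : (fun t0 : R => cos (l * (t0 - 2^-1))) = cos \o (l \*: (id - cst 2^-1)).
  by apply/funext => x.
by apply: is_derive_eq; rewrite /= subr0 /GRing.scale/=; ring.
Qed.

Lemma is_derive2_weight l t :
  is_derive t 1 (fun s => - (l * sin (l * (s - 2^-1)))) (- (l ^+ 2 * weight l t)).
Proof.
have -> : (fun s : R => - (l * sin (l * (s - 2^-1)))) =
    (- l) \*: (sin \o (l \*: (id - cst 2^-1))).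
  by apply/funext => x /=; rewrite /GRing.scale/= mulNr.
by apply: is_derive_eq; rewrite /= subr0 /GRing.scale/= /weight; ring.
Qed.

Lemma weight_continuous l : continuous (weight l).
Proof.
move=> t; apply: differentiable_continuous; apply/derivable1_diffP.
by have [] := is_derive_weight l t.
Qed.

Lemma weight_le1 l t : weight l t <= 1.
Proof. exact: cos_le1. Qed.

(** The cosine is even and decreasing on [[0, pi]], and [|t - 1/2| <= 1/2]. *)
Lemma weight_ge l t : 0 < l < pi -> 0 <= t <= 1 -> cos (l / 2) <= weight l t.
Proof.
move=> /andP[l0 lpi] /andP[t0 t1]; rewrite /weight.
have -> : cos (l * (t - 2^-1)) = cos (l * `|t - 2^-1|).
  by case: ger0P => // _; rewrite mulrN cosN.
have t2 : `|t - 2^-1| <= 2^-1 by rewrite ler_norml; lra.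
have h : l * `|t - 2^-1| <= l / 2 by rewrite ler_pM2l.
have h0 : 0 <= l * `|t - 2^-1| by rewrite mulr_ge0// ltW.
by rewrite leNgt ltr_cos ?in_itv/= -?leNgt//; lra.
Qed.

Lemma cos_half_gt0 l : 0 < l < pi -> 0 < cos (l / 2).
Proof. by move=> lpi; apply: cos_gt0_pihalf; lra. Qed.

(** Both derivatives are carried as explicit functions. Differentiability is asked in the open
    interval only, and [ddu] need not be continuous. *)
Definition C2_01 (u du ddu : R -> R) : Prop :=
  [/\ {within `[0, 1], continuous u}, {within `[0, 1], continuous du},
      forall t, 0 < t < 1 -> is_derive t 1 u (du t) &
      forall t, 0 < t < 1 -> is_derive t 1 du (ddu t)].

Lemma C2_01B (u du ddu w dw ddw : R -> R) :
  C2_01 u du ddu -> C2_01 w dw ddw -> C2_01 (u - w) (du - dw) (ddu - ddw).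
Proof.
move=> [cu cdu hu hdu] [cw cdw hw hdw]; split.
- exact: within_continuousB.
- exact: within_continuousB.
- by move=> t t01; apply: is_deriveB; [exact: hu|exact: hw].
- by move=> t t01; apply: is_deriveB; [exact: hdu|exact: hdw].
Qed.

Lemma C2_01Z k (u du ddu : R -> R) :
  C2_01 u du ddu -> C2_01 (k \*: u) (k \*: du) (k \*: ddu).
Proof.
move=> [cu cdu hu hdu]; split.
- by move=> x; apply: (@cvgZl_tmp R R^o); exact: cu.
- by move=> x; apply: (@cvgZl_tmp R R^o); exact: cdu.
- by move=> t t01; apply: is_deriveZ; exact: hu.
- by move=> t t01; apply: is_deriveZ; exact: hdu.
Qed.

Lemma C2_01_weight l :
  C2_01 (weight l) (fun s => - (l * sin (l * (s - 2^-1))))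
        (fun s => - (l ^+ 2 * weight l s)).
Proof.
split=> [| |t _|t _].
- by apply: continuous_subspaceT; exact: weight_continuous.
- apply: continuous_subspaceT => t.
  apply: differentiable_continuous; apply/derivable1_diffP.
  by have [] := is_derive2_weight l t.
- exact: is_derive_weight.
- exact: is_derive2_weight.
Qed.

(** At an interior maximum [dz c = 0]. If [ddz c] were positive, [dz] would be positive just to the
    right of [c], and the mean value theorem would give a larger value of [z] there. *)
Lemma interior_max_second_derivative (z dz ddz : R -> R) c :
  C2_01 z dz ddz -> 0 < c < 1 -> (forall t, 0 <= t <= 1 -> z t <= z c) ->
  ddz c <= 0.
Proof.
move=> [cz cdz hz hdz] c01 zmax; rewrite leNgt; apply/negP => ddz0.
have [c0 c1] : 0 < c /\ c < 1 by case/andP: c01.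
have dzc0 : dz c = 0.
  have h1 : is_derive c 1 z 0.
    apply: (@derive1_at_max _ z 0 1) => //.
    - by move=> t; rewrite in_itv/= => t01; have [] := hz t t01.
    - by move=> t; rewrite in_itv/= => /andP[t0 t1]; apply: zmax; rewrite !ltW.
  by have [_ <-] := hz c c01; have [_ ->] := h1.
have [ddz1 ddzE] := hdz c c01.
(* The tolerance in the limit of the difference quotients is [ddz c] itself, which keeps them
   positive. *)
have : \forall h \near 0^', 0 < h^-1 *: (dz (h *: 1 + c) - dz c).
  move: ddz1 => /cvgrPdist_lt /(_ _ ddz0).
  rewrite -/('D_1 dz c) ddzE.
  by apply: filterS => h /=; rewrite ltr_norml => /andP[_]; lra.
rewrite dzc0 /= => /nbhs_ballP[e /= e0 he].
pose d := Num.min (e / 2) ((1 - c) / 2).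
have d0 : 0 < d by rewrite lt_min; apply/andP; split; lra.
have de : d <= e / 2 by rewrite /d ge_min lexx.
have dc : d <= (1 - c) / 2 by rewrite /d ge_min lexx orbT.
have [|||s] := @MVT _ z dz c (c + d).
- by rewrite ltrDl.
- by move=> x; rewrite in_itv/= => xc; apply: hz; lra.
- apply: continuous_subspaceW cz => x /=; rewrite !in_itv/=; lra.
rewrite in_itv/= => /andP[cs sd] E.
have : z (c + d) <= z c by apply: zmax; lra.
apply/negP; rewrite -ltNge -subr_gt0 E pmulr_lgt0; last lra.
have := he (s - c); rewrite /ball/= sub0r normrN gtr0_norm ?subr_gt0//.
have sc : 0 < s - c by rewrite subr_gt0.
move=> /(_ ltac:(lra) (lt0r_neq0 sc)).
rewrite subr0 /GRing.scale/= mulr1 subrK pmulr_rgt0//.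
by rewrite invr_gt0.
Qed.

(* If z / w attains its maximum p > K at c, then z - p w is maximal at c, so
   z'' <= p w'' = - l^2 z there. *)
Lemma comparison l K (z dz ddz : R -> R) : 0 < l < pi -> 0 <= K ->
  C2_01 z dz ddz -> z 0 <= 0 -> z 1 <= 0 ->
  (forall t, 0 < t < 1 -> K * weight l t < z t -> - l ^+ 2 * z t < ddz t) ->
  forall t, 0 <= t <= 1 -> z t <= K * weight l t.
Proof.
move=> lpi K0 Hz z0 z1 Hdd t t01; rewrite leNgt; apply/negP => Kzt.
have w0 s : 0 <= s <= 1 -> 0 < weight l s.
  by move=> s01; apply: lt_le_trans (cos_half_gt0 _ lpi) _; exact: weight_ge.
pose p s := z s / weight l s.
have cp : {within `[0, 1], continuous p}.
  apply/subspace_continuousP => s s01.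
  apply: cvgM.
    by case: Hz => /subspace_continuousP cz _ _ _; exact: cz.
  apply: cvgV; first by rewrite gt_eqF// w0//; move: s01; rewrite /= in_itv.
  by apply: cvg_within_filter; exact: weight_continuous.
have [c] := EVT_max ler01 cp.
rewrite in_itv/= => c01 pmax.
have zp s : 0 <= s <= 1 -> z s = p s * weight l s.
  by move=> s01; rewrite /p divfK// gt_eqF// w0.
have Kp : K < p c.
  apply: lt_le_trans (pmax t _); last by rewrite in_itv.
  by rewrite /p ltr_pdivlMr// w0.
have zc0 : 0 < z c by rewrite zp//; apply: mulr_gt0; [lra|exact: w0].
have c01' : 0 < c < 1.
  case/andP: c01 => c0 c1; rewrite !lt_neqAle c0 c1 !andbT.
  by apply/andP; split; apply/eqP => E; move: zc0; [rewrite -E|rewrite E]; lra.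
have Hq := C2_01B _ _ _ _ _ _ Hz (C2_01Z (p c) _ _ _ (C2_01_weight l)).
have := Hdd c c01'; rewrite [X in _ < X -> _]zp// ltr_pM2r ?w0// => /(_ Kp).
have /= := interior_max_second_derivative _ _ _ c Hq c01' _.
rewrite !fctE /GRing.scale/= => H.
suff /H : forall t : R, 0 <= t <= 1 -> z t - p c * weight l t <= z c - p c * weight l c.
  rewrite [z c]zp// scalerN opprK => h1 h2.
  by have h3 : ddz c + p c * (l ^+ 2 * weight l c) <= 0 := h1; lra.
move=> s s01.
rewrite -zp// subrr subr_le0 zp// ler_pM2r ?w0//.
by apply: pmax; rewrite in_itv.
Qed.

End Comparison.

(** * The linear problem with constant coefficients *)

Section LinearSolve.
Context {R : realType}.
Local Notation leb := (@lebesgue_measure R).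
Implicit Types h : R -> R.

Definition primitive h (t : R) : R := \int[leb]_(s in `[0, t]) h s.

Lemma continuous_integrable h (a b : R) : {within `[a, b], continuous h} ->
  leb.-integrable `[a, b] (EFin \o h).
Proof. by move=> ch; apply: continuous_compact_integrable => //; exact: segment_compact. Qed.

Lemma primitive0 h : primitive h 0 = 0.
Proof. by rewrite /primitive set_itv1 Rintegral_set1. Qed.

Lemma is_derive_primitive h t : leb.-integrable `[0, 1] (EFin \o h) ->
  0 < t < 1 -> {for t, continuous h} -> is_derive t 1 (primitive h) (h t).
Proof.
move=> ih /andP[t0 t1] ch.
by have [? <-] := continuous_FTC1_closed t1 ih t0 ch; rewrite derive1E; exact: DeriveDef.
Qed.

Lemma primitive_continuous h : leb.-integrable `[0, 1] (EFin \o h) ->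
  {within `[0, 1], continuous (primitive h)}.
Proof. by move=> ih; exact: parameterized_integral_continuous. Qed.

(* Variation of constants: with P = int_0^t e^(-ks) h and Q = int_0^t e^(ks) h,
   - (e^(kt) P - e^(-kt) Q) / (2k) solves - u'' + k^2 u = h with u(0) = 0; a
   multiple of e^(kt) - e^(-kt) is then added to get u(1) = 0. *)
Lemma linear_dirichlet_solvable (k : R) h : 0 < k -> continuous h ->
  exists u du : R -> R,
    [/\ C2_01 u du (fun t => k ^+ 2 * u t - h t), u 0 = 0 & u 1 = 0].
Proof.
move=> k0 ch.
pose E (c t : R) : R := expR (c * t).
have dE (c t : R) : is_derive t 1 (E c) (c * E c t).
  rewrite /E; have -> : (fun t0 : R => expR (c * t0)) = expR \o (c \*: id) by [].
  by apply: is_derive_eq; rewrite /GRing.scale/= mulr1 mulrC.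
have cE (c : R) : continuous (E c).
  by move=> t; apply: differentiable_continuous; apply/derivable1_diffP; have [] := dE c t.
have cEh (c : R) : continuous (fun t => E c t * h t).
  by move=> t; apply: cvgM; [exact: cE|exact: ch].
have iEh (c : R) : leb.-integrable `[0, 1] (EFin \o (fun t => E c t * h t)).
  by apply: continuous_integrable; exact: continuous_subspaceT.
pose P (c : R) := primitive (fun t => E c t * h t).
have dP (c t : R) : 0 < t < 1 -> is_derive t 1 (P c) (E c t * h t).
  by move=> t01; apply: (is_derive_primitive _ _ (iEh c) t01); exact: cEh.
have cP (c : R) : {within `[0, 1], continuous (P c)} by exact: primitive_continuous.
(* In the derivative of [up] the two terms containing [h] cancel; in that of [dup] they add up, and
   this identity reduces them to [- h]. *)
have EE (t : R) : E k t * E (- k) t = 1 by rewrite /E -expRD mulNr subrr expR0.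
pose up (C t : R) :=
  C * (E k t - E (- k) t) - (2 * k)^-1 * (E k t * P (- k) t - E (- k) t * P k t).
pose dup (C t : R) :=
  C * k * (E k t + E (- k) t) - 2^-1 * (E k t * P (- k) t + E (- k) t * P k t).
have cEw (c : R) : {within `[0, 1], continuous (E c)} by exact: continuous_subspaceT.
have s0 : E k 1 - E (- k) 1 != 0.
  by rewrite subr_eq0 gt_eqF// /E ltr_expR !mulr1; lra.
pose C := (2 * k)^-1 * (E k 1 * P (- k) 1 - E (- k) 1 * P k 1) / (E k 1 - E (- k) 1).
exists (up C), (dup C); split; first split.
- move=> t; apply: cvgB; apply: cvgM; try exact: cvg_cst.
  + by apply: cvgB; exact: cEw.
  + by apply: cvgB; apply: cvgM; first [exact: cEw | exact: cP].
- move=> t; apply: cvgB; apply: cvgM; try exact: cvg_cst.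
  + by apply: cvgD; exact: cEw.
  + by apply: cvgD; apply: cvgM; first [exact: cEw | exact: cP].
- move=> t t01; have d1 := dP k t t01; have d2 := dP (- k) t t01.
  have -> : up C = C \*: (E k - E (- k)) - (2 * k)^-1 \*: (E k * P (- k) - E (- k) * P k) by [].
  apply: is_derive_eq; rewrite /GRing.scale/= /dup.
  transitivity (C * (k * E k t - - k * E (- k) t) -
    (2 * k)^-1 * (k * (E k t * P (- k) t + E (- k) t * P k t))).
    by ring.
  by field; rewrite gt_eqF.
- move=> t t01; have d1 := dP k t t01; have d2 := dP (- k) t t01.
  have -> : dup C = (C * k) \*: (E k + E (- k)) - 2^-1 \*: (E k * P (- k) + E (- k) * P k) by [].
  apply: is_derive_eq; rewrite /GRing.scale/= /up.
  transitivity (C * k * (k * E k t - k * E (- k) t) -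
    2^-1 * (k * (E k t * P (- k) t - E (- k) t * P k t) + 2 * ((E k t * E (- k) t) * h t))).
    by ring.
  by rewrite EE; field; rewrite gt_eqF.
- by rewrite /up /P !primitive0 /E !mulr0 !expR0; ring.
- by rewrite /up /C divfK// subrr.
Qed.

End LinearSolve.

(** * Contraction argument for the semilinear problem *)

Section FixedPoint.
Context {R : realType}.

(** Banach's argument with the weighted sup norm kept implicit: distance at most [D] is the
    pointwise bound [D * w t]. The Picard iterates from 0 converge uniformly because [w <= 1], so
    their limit is continuous. *)
Lemma weighted_fixed_point (w : R -> R) (T : (R -> R) -> R -> R) (q D0 : R) :
  0 <= q < 1 -> 0 <= D0 -> (forall t, 0 <= w t <= 1) ->
  (forall a, continuous a -> continuous (T a)) ->
  (forall a b D, continuous a -> continuous b -> 0 <= D ->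
     (forall t, `|a t - b t| <= D * w t) ->
     forall t, `|T a t - T b t| <= q * D * w t) ->
  (forall t, `|T (cst 0) t| <= D0 * w t) ->
  exists2 u, continuous u & T u =1 u.
Proof.
move=> /andP[q0 q1] D00 w01 cT contr T0.
pose u_ n := iter n T (cst 0).
have cu n : continuous (u_ n).
  by elim: n => [|n IHn]; [exact: cst_continuous|exact: cT].
have qn0 n : 0 <= q ^+ n by exact: exprn_ge0.
have step n t : `|u_ n.+1 t - u_ n t| <= q ^+ n * D0 * w t.
  elim: n t => [|n IHn] t; first by rewrite expr0 mul1r /u_ /= subr0.
  rewrite exprS -[q * _ * _]mulrA.
  by apply: (contr (u_ n.+1)) => //; exact: mulr_ge0.
have q1' : 1 - q != 0 by rewrite subr_eq0 gt_eqF.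
(* [D = D0 / (1 - q)] is the sum of the geometric series of the step bounds [q ^+ n * D0]; the
   finite sums in [gap] then have a closed form. *)
have [D D_ge0 D0E] : exists2 D, 0 <= D & D0 = D * (1 - q).
  by exists (D0 / (1 - q)); rewrite ?divfK// divr_ge0// subr_ge0 ltW.
have gap n k t : `|u_ (n + k)%N t - u_ n t| <= D * q ^+ n * (1 - q ^+ k) * w t.
  elim: k => [|k IHk]; first by rewrite addn0 !subrr normr0 mulr0 mul0r.
  rewrite addnS; apply: le_trans (ler_distD (u_ (n + k)%N t) _ _) _.
  have := step (n + k)%N t; rewrite D0E exprD exprS; lra.
have gap' n k t : `|u_ (n + k)%N t - u_ n t| <= D * q ^+ n * w t.
  apply: le_trans (gap n k t) _; case/andP: (w01 t) => w0 _.
  apply: ler_wpM2r => //; rewrite ler_piMr ?mulr_ge0//.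
  by have := qn0 k; lra.
have small e : 0 < e -> exists n, D * q ^+ n < e.
  move=> e0; have q1n : `|q| < 1 by rewrite ger0_norm.
  have /cvgrPdist_lt/(_ _ e0)[N _ /(_ N (leqnn N))] := cvg_geometric D q1n.
  by rewrite /= sub0r normrN ger0_norm ?mulr_ge0// => h; exists N.
have Dqw n t : D * q ^+ n * w t <= D * q ^+ n.
  by case/andP: (w01 t) => _ w1; rewrite ler_piMr ?mulr_ge0.
have cvu t : cvg (u_ n t @[n --> \oo]).
  apply/cauchy_cvgP/cauchy_exP => e e0.
  have [n ne] := small e e0.
  exists (u_ n t), n => // m /= nm.
  rewrite /ball/= distrC -(subnKC nm).
  by apply: le_lt_trans (gap' _ _ _) _; apply: le_lt_trans ne.
pose u t := limn (fun n => u_ n t).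
have uu n t : `|u t - u_ n t| <= D * q ^+ n * w t.
  have cv : `|u_ k t - u_ n t| @[k --> \oo] --> `|u t - u_ n t|.
    by apply: cvg_norm; apply: cvgB; [exact: cvu|exact: cvg_cst].
  rewrite -(cvg_lim _ cv)//; apply: limr_le; first by apply/cvg_ex; eexists; exact: cv.
  by exists n => // k /= nk; rewrite -(subnKC nk).
have cont_u : continuous u.
  move=> t; apply/cvgrPdist_lt => e e0.
  have [|n ne] := small (e / 3); first by lra.
  have e30 : 0 < e / 3 by lra.
  have /cvgrPdist_lt/(_ _ e30) := cu n t.
  apply: filterS => s.
  have := le_trans (uu n t) (Dqw n t); have := le_trans (uu n s) (Dqw n s).
  by rewrite !ler_norml !ltr_norml => /andP[? ?] /andP[? ?] /andP[? ?]; lra.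
exists u => // t; apply/eqP; rewrite -subr_eq0 -normr_eq0; apply/eqP.
apply: le_anti; rewrite normr_ge0 andbT leNgt; apply/negP => Tu0.
(* Both [T u] and [u] lie within [D * q ^+ n] of the iterate [n.+1] at [t], which is too close if
   this bound is below half of their distance. *)
have [|n ne] := small (`|T u t - u t| / 2); first by lra.
have h1 := contr u (u_ n) (D * q ^+ n) cont_u (cu n) (mulr_ge0 D_ge0 (qn0 n)) (uu n) t.
have h2 := uu n.+1 t.
have h3 := ler_distD (u_ n.+1 t) (T u t) (u t).
have h4 : q * (D * q ^+ n) * w t <= D * q ^+ n.
  apply: le_trans (Dqw n t); case/andP: (w01 t) => w0 _.
  by apply: ler_wpM2r => //; rewrite ler_piMl ?mulr_ge0// ltW.
have h5 : D * q ^+ n.+1 * w t <= D * q ^+ n by rewrite exprS mulrCA.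
move: h1 h2 h3; rewrite -[T (u_ n)]/(u_ n.+1) (distrC (u_ n.+1 t)); lra.
Qed.

Lemma C2_01_ext (u du ddu ddw : R -> R) :
  (forall t, 0 < t < 1 -> ddu t = ddw t) -> C2_01 u du ddu -> C2_01 u du ddw.
Proof. by move=> E [cu cdu hu hdu]; split=> // t t01; rewrite -E//; exact: hdu. Qed.

(** By the bounds on increments, [x |-> M x - F t x] is nondecreasing with slopes at most [M - m].
    The maximum principle turns this into the ratio [(M - m) / (M + l^2)], which is below 1 because
    [- l^2 < m]. *)
Lemma semilinear_dirichlet_solvable (l m M : R) (F : R -> R -> R) :
  0 < l < pi -> 0 < M -> - l ^+ 2 < m -> m <= M ->
  (forall u, continuous u -> continuous (fun t => F t (u t))) ->
  (forall t x y, x <= y -> m * (y - x) <= F t y - F t x <= M * (y - x)) ->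
  exists u du : R -> R,
    [/\ C2_01 u du (fun t => F t (u t)), u 0 = 0 & u 1 = 0].
Proof.
move=> lpi M0 lm mM cF HF.
(* [S h] is a chosen solution of [- u'' + M u = h] with its derivative, obtained with [k] the square
   root of [M]; for discontinuous [h] the value is arbitrary. *)
have [S HS] : {S : (R -> R) -> (R -> R) * (R -> R) & forall h, continuous h ->
   [/\ C2_01 (S h).1 (S h).2 (fun t => M * (S h).1 t - h t), (S h).1 0 = 0 & (S h).1 1 = 0]}.
  apply: (@choice _ _ (fun h p => continuous h ->
    [/\ C2_01 p.1 p.2 (fun t => M * p.1 t - h t), p.1 0 = 0 & p.1 1 = 0])) => h.
  have [ch|nch] := pselect (continuous h); last by exists (cst 0, cst 0).
  have s0 : 0 < Num.sqrt M by rewrite sqrtr_gt0.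
  have [u [du]] := linear_dirichlet_solvable _ _ s0 ch.
  by rewrite sqr_sqrtr ?ltW// => H; exists (u, du).
pose H (a : R -> R) t := M * a t - F t (a t).
have cH a : continuous a -> continuous (H a).
  move=> ca t; apply: cvgB; last exact: cF.
  by apply: cvgM; [exact: cvg_cst|exact: ca].
pose w (t : R) := weight l (clamp 0 1 t).
have c01 (t : R) : 0 <= clamp 0 1 t <= 1 by exact: clamp_itv.
have w_ge t : cos (l / 2) <= w t by exact: weight_ge.
have cos0 := cos_half_gt0 _ lpi.
have w01 t : 0 <= w t <= 1 by rewrite weight_le1 andbT; have := w_ge t; lra.
(* Clamping the time makes [T a] continuous on the whole line, as [w] is bounded below by
   [cos (l / 2)] on the whole line. *)
pose T (a : R -> R) : R -> R := (S (H a)).1 \o clamp 0 1.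
have cT a : continuous a -> continuous (T a).
  by move=> ca; have [[? _ _ _] _ _] := HS _ (cH a ca); exact: within_continuous_clamp.
have Ml : 0 < M + l ^+ 2 by have := sqr_ge0 l; lra.
pose q := (M - m) / (M + l ^+ 2).
have q01 : 0 <= q < 1.
  by rewrite divr_ge0 ?subr_ge0//= ?ltr_pdivrMr ?mul1r//; lra.
have half a b D : continuous a -> continuous b -> 0 <= D ->
    (forall t, `|a t - b t| <= D * w t) ->
    forall t, T a t - T b t <= q * D * w t.
  move=> ca cb D0 ab t.
  have [C2a a0 a1] := HS _ (cH a ca); have [C2b b0 b1] := HS _ (cH b cb).
  have qD0 : 0 <= q * D by rewrite mulr_ge0//; case/andP: q01.
  apply: (comparison l _ _ _ _ lpi qD0 (C2_01B _ _ _ _ _ _ C2a C2b)) => //=.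
  - by rewrite !fctE a0 b0 subrr.
  - by rewrite !fctE a1 b1 subrr.
  - move=> s s01; rewrite !fctE => h.
    have := ab s; rewrite /w clamp_id; last by case/andP: s01 => *; rewrite !ltW.
    have : q * (M + l ^+ 2) = M - m by rewrite /q divfK// gt_eqF.
    move: h; rewrite /H ler_norml.
    set z := (S _).1 s - (S _).1 s => h qE /andP[ab1 ab2].
    (* With [z'' = M z - (H a - H b)], the required [z'' > - l^2 z] reads [(M + l^2) z > H a - H b].
       It follows from this bound and [K1]. *)
    have hz : (M - m) * (D * weight l s) < (M + l ^+ 2) * z.
      by rewrite -qE; move: h; rewrite -(ltr_pM2l Ml); lra.
    have Mm : 0 <= M - m by lra.
    have K1 : M * a s - F s (a s) - (M * b s - F s (b s)) <= (M - m) * (D * weight l s).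
      case: (lerP (a s) (b s)) => [abs|/ltW abs]; have /andP[e1 e2] := HF s _ _ abs.
      + have : 0 <= (M - m) * (D * weight l s) by rewrite mulr_ge0//; lra.
        lra.
      + have : (M - m) * (a s - b s) <= (M - m) * (D * weight l s) by rewrite ler_wpM2l.
        lra.
    have -> : M * (S (fun t0 => M * a t0 - F t0 (a t0))).1 s -
       (M * a s - F s (a s)) - (M * (S (fun t0 => M * b t0 - F t0 (b t0))).1 s -
       (M * b s - F s (b s))) = M * z - (M * a s - F s (a s) - (M * b s - F s (b s))).
      by rewrite /z; ring.
    lra.
have T0 : exists2 D0, 0 <= D0 & forall t, `|T (cst 0) t| <= D0 * w t.
  have cT0 : {within `[0, 1], continuous (fun t => `|T (cst 0) t|)}.
    apply: continuous_subspaceT => t; apply: cvg_norm; apply: cT.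
    exact: cst_continuous.
  have [c _ cmax] := EVT_max ler01 cT0.
  (* Dividing the maximum by the lower bound of [w] turns a uniform bound into a weighted one. *)
  exists (`|T (cst 0) c| / cos (l / 2)); first by rewrite divr_ge0// ltW.
  move=> t; have -> : T (cst 0) t = T (cst 0) (clamp 0 1 t).
    by rewrite /T/= [in RHS]clamp_id.
  apply: le_trans (cmax _ _) _; first by rewrite in_itv/=.
  by rewrite -mulrA ler_peMr// mulrC ler_pdivlMr// mul1r.
have [D0 D00 T0D] := T0.
(* [half] bounds the difference from one side; exchanging [a] and [b] gives the other. *)
have [|u cu Tu] := weighted_fixed_point w T q D0 q01 D00 w01 cT _ T0D.
  move=> a b D ca cb D0' ab t; rewrite ler_norml lerNl opprB.
  by rewrite !half// => s; rewrite distrC.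
have [C2u u0 u1] := HS _ (cH u cu).
exists (S (H u)).1, (S (H u)).2; split => //.
apply: C2_01_ext C2u => t t01; rewrite /H.
have <- : u t = (S (H u)).1 t.
  by rewrite -Tu /T/= clamp_id//; case/andP: t01 => *; rewrite !ltW.
by ring.
Qed.

End FixedPoint.

(** * Square integrable functions, primitives and the space H^1 *)

Section SobolevSpace.
Context {R : realType}.
Local Notation leb := (@lebesgue_measure R).
Implicit Types g h x dx y dy : R -> R.

Lemma L2_01_continuous g : {within `[0, 1], continuous g} -> L2_01 g.
Proof.
move=> cg; split; first by apply: subspace_continuous_measurable_fun.
apply: continuous_integrable => t; apply: cvgM; exact: cg.
Qed.

(** The function is dominated through [|g| <= 1 + g^2], on an interval of finite measure. *)
Lemma L2_01_integrable g : L2_01 g -> leb.-integrable `[0, 1] (EFin \o g).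
Proof.
move=> [mg ig].
have i1 : leb.-integrable `[0, 1] (EFin \o (fun=> 1 : R)).
  by apply: continuous_integrable; apply: continuous_subspaceT => t; exact: cvg_cst.
apply: (le_integrable _ _ _ (integrableD _ i1 ig)) => //.
- exact/measurable_EFinP.
- move=> t _ /=; rewrite lee_fin [leRHS]ger0_norm ?addr_ge0 ?sqr_ge0//.
  by rewrite ler_norml; nra.
Qed.

(** Domination by [2 a^2 g^2 + 2 b^2 h^2], as [(a g - b h)^2 >= 0]. *)
Lemma L2_01_lincomb (a b : R) g h : L2_01 g -> L2_01 h ->
  L2_01 (fun t => a * g t + b * h t).
Proof.
move=> [mg ig] [mh ih].
have m1 : measurable_fun `[(0:R), 1] (fun t => a * g t + b * h t).
  by apply: measurable_funD; apply: measurable_funM => //; exact: measurable_cst.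
split=> //.
have k1 : leb.-integrable `[0, 1] (fun t => (2 * a ^+ 2)%:E * (g t ^+ 2)%:E)%E.
  exact: integrableZl.
have k2 : leb.-integrable `[0, 1] (fun t => (2 * b ^+ 2)%:E * (h t ^+ 2)%:E)%E.
  exact: integrableZl.
apply: (le_integrable _ _ _ (integrableD _ k1 k2)) => //.
- by apply/measurable_EFinP; apply: measurable_funX.
- move=> t _ /=; rewrite lee_fin [leLHS]ger0_norm ?sqr_ge0//.
  apply: le_trans (ler_norm _); have := sqr_ge0 (a * g t - b * h t); lra.
Qed.

Lemma integrable_subitv g t : leb.-integrable `[0, 1] (EFin \o g) -> 0 <= t <= 1 ->
  leb.-integrable `[0, t] (EFin \o g).
Proof.
move=> ig /andP[t0 t1]; apply: integrableS ig => // s /=.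
by rewrite !in_itv/= => /andP[->] /le_trans; exact.
Qed.

Lemma primitive_lincomb (a b : R) g h t : leb.-integrable `[0, 1] (EFin \o g) ->
  leb.-integrable `[0, 1] (EFin \o h) -> 0 <= t <= 1 ->
  primitive (fun s => a * g s + b * h s) t = a * primitive g t + b * primitive h t.
Proof.
move=> ig ih t01.
have kg := integrable_subitv _ _ ig t01; have kh := integrable_subitv _ _ ih t01.
rewrite /primitive RintegralD// ?RintegralZl//.
- exact: (@integrableZl _ _ _ leb _ _ a _ kg).
- exact: (@integrableZl _ _ _ leb _ _ b _ kh).
Qed.

Lemma H1_01_lincomb (a b : R) x dx y dy : H1_01 x dx -> H1_01 y dy ->
  H1_01 (fun t => a * x t + b * y t) (fun t => a * dx t + b * dy t).
Proof.
move=> [Lx [Ldx hx]] [Ly [Ldy hy]]; split; first exact: L2_01_lincomb.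
split; first exact: L2_01_lincomb.
move=> t t01; rewrite hx// hy//.
rewrite -/(primitive (fun s => a * dx s + b * dy s) t).
rewrite primitive_lincomb //; try exact: L2_01_integrable.
by rewrite /primitive; ring.
Qed.

Lemma H1_01_primitive g : L2_01 g -> H1_01 (primitive g) g.
Proof.
move=> Lg; split.
  by apply: L2_01_continuous; apply: primitive_continuous; exact: L2_01_integrable.
by split=> // t _; rewrite primitive0 add0r.
Qed.

Lemma H1_01_continuous x dx : H1_01 x dx -> {within `[0, 1], continuous x}.
Proof.
move=> [_ [Ldx hx]].
apply: (@subspace_eq_continuous _ _ _ (cst (x 0) + primitive dx)).
  by move=> t /set_mem; rewrite /= in_itv/= => t01; exact/esym/hx.
apply: within_continuousD; last by apply: primitive_continuous; exact: L2_01_integrable.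
by apply: continuous_subspaceT => t; exact: cvg_cst.
Qed.

Lemma within_continuous_interior g (t : R) : {within `[0, 1], continuous g} ->
  0 < t < 1 -> {for t, continuous g}.
Proof. by move=> /(continuous_within_itvP _ ltr01)[cg _ _] t01; exact: cg. Qed.

Lemma near_itv01 (t : R) (P : R -> Prop) : 0 < t < 1 ->
  (forall s, 0 <= s <= 1 -> P s) -> \forall s \near t, P s.
Proof.
move=> t01 HP; have : t \in `]0, 1[%R by rewrite in_itv.
move=> /near_in_itvoo; apply: filterS => s; rewrite in_itv/= => /andP[s0 s1].
by apply: HP; rewrite !ltW.
Qed.

(** This passes from an integral identity, known only on [[0, 1]], to a classical derivative: near
    an interior point the two sides coincide. *)
Lemma primitive_shift_is_derive x g t : leb.-integrable `[0, 1] (EFin \o g) ->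
  (forall s, 0 <= s <= 1 -> x s = x 0 + primitive g s) ->
  0 < t < 1 -> {for t, continuous g} -> is_derive t 1 x (g t).
Proof.
move=> ig hx t01 cg.
apply: (@near_eq_is_derive _ _ _ (cst (x 0) + primitive g)).
  by apply: near_itv01 => // s /hx ->.
have ? := is_derive_primitive _ _ ig t01 cg.
by apply: is_derive_eq; rewrite add0r.
Qed.

Lemma H1_01_intro x dx : {within `[0, 1], continuous x} ->
  {within `[0, 1], continuous dx} ->
  (forall t : R, 0 < t < 1 -> is_derive t 1 x (dx t)) -> H1_01 x dx.
Proof.
move=> cx cdx hx; split; [exact: L2_01_continuous|split; first exact: L2_01_continuous].
(* The fundamental theorem of calculus is applied on a nondegenerate interval, so [t = 0] is
   separate. *)
move=> t /andP[]; rewrite le_eqVlt => /predU1P[<- _|t0 t1].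
  by rewrite -/(primitive dx 0) primitive0 addr0.
have sub : `[0, t] `<=` `[0, 1].
  by move=> s /=; rewrite !in_itv/= => /andP[->] /le_trans; exact.
have cxt := continuous_subspaceW sub cx.
rewrite /Rintegral (@continuous_FTC2 _ dx x)//=.
- by ring.
- exact: continuous_subspaceW cdx.
- have [c1 c2 c3] := (continuous_within_itvP _ t0).1 cxt.
  split=> // s; rewrite in_itv/= => /andP[s0 st].
  by have [] := hx s; first by rewrite s0 (lt_le_trans st).
- move=> s; rewrite in_itv/= => /andP[s0 st].
  by rewrite derive1E; have [] := hx s; first by rewrite s0 (lt_le_trans st).
Qed.

Lemma H1_01_cst (c : R) : H1_01 (cst c) (cst 0).
Proof.
by apply: H1_01_intro => //;
  apply: continuous_subspaceT => t; exact: cvg_cst.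
Qed.

Lemma H1_01_id : H1_01 (@id R) (cst 1).
Proof.
apply: H1_01_intro => //.
  by apply: continuous_subspaceT => t; exact: cvg_id.
by apply: continuous_subspaceT => t; exact: cvg_cst.
Qed.

End SobolevSpace.

(** * Comparison of solutions, a priori bound and existence for the Dirichlet problem *)

Section DirichletProblem.
Context {R : realType}.
Local Notation leb := (@lebesgue_measure R).

(** The midpoint of the square root of [c] and [pi] serves. *)
Lemma exists_frequency (c : R) : 0 <= c < pi ^+ 2 ->
  exists l : R, 0 < l < pi /\ c < l ^+ 2.
Proof.
move=> /andP[c0 cpi]; have pi0 := pi_gt0 R.
have s0 := sqrtr_ge0 c; have sE : Num.sqrt c ^+ 2 = c by exact: sqr_sqrtr.
have spi : Num.sqrt c < pi by rewrite -(@ltr_pXn2r _ 2)// ?nnegrE ?sE// ltW.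
exists ((Num.sqrt c + pi) / 2); split; first lra.
by rewrite -[X in X < _]sE ltr_pXn2r// ?nnegrE; lra.
Qed.

(** In [y1 - y2] the term [v] cancels, so the second derivative agrees almost everywhere with a
    continuous function and the difference is a classical [C2_01] function. The maximum principle
    with [K = 0] then applies. *)
Lemma dirichlet_solution_le (f : R -> R -> R) (v y1 y2 : R -> R) (l : R) :
  0 < l < pi ->
  {within [set p : R * R | p.1 \in `[(0:R), 1]], continuous (fun p => f p.1 p.2)} ->
  (forall t x y : R, 0 <= t <= 1 -> x < y -> - l ^+ 2 * (y - x) < f t y - f t x) ->
  dirichlet_solution f v y1 -> dirichlet_solution f v y2 ->
  forall t, 0 <= t <= 1 -> y1 t <= y2 t.
Proof.
move=> lpi cf hf [dy1 [ddy1 [y10 y11 Hy1 Hdy1 E1]]] [dy2 [ddy2 [y20 y21 Hy2 Hdy2 E2]]].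
have cy1 := H1_01_continuous _ _ Hy1; have cy2 := H1_01_continuous _ _ Hy2.
have cdy1 := H1_01_continuous _ _ Hdy1; have cdy2 := H1_01_continuous _ _ Hdy2.
have cfy (y : R -> R) : {within `[0, 1], continuous y} ->
    continuous (fun t => f (clamp 0 1 t) (y (clamp 0 1 t))).
  move=> cy; pose p (t : R) := (clamp 0 1 t, y (clamp 0 1 t)).
  have cp : continuous p.
    move=> t; exact: (cvg_pair (clamp_continuous 0 1 t) (within_continuous_clamp _ _ _ ler01 cy t)).
  apply: (within_continuous_in _ _ _ _ _ p cf cp) => t.
  by rewrite /= in_itv/= clamp_itv.
pose phi t := f (clamp 0 1 t) (y1 (clamp 0 1 t)) - f (clamp 0 1 t) (y2 (clamp 0 1 t)).
have cphi : continuous phi.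
  by move=> t; apply: cvgB; [exact: (cfy _ cy1)|exact: (cfy _ cy2)].
have iphi : leb.-integrable `[0, 1] (EFin \o phi).
  by apply: continuous_integrable; exact: continuous_subspaceT.
have [_ [Lddy1 hdy1]] := Hdy1; have [_ [Lddy2 hdy2]] := Hdy2.
have i1 := L2_01_integrable _ Lddy1; have i2 := L2_01_integrable _ Lddy2.
have hdz (t : R) : 0 <= t <= 1 -> (dy1 - dy2) t = (dy1 - dy2) 0 + primitive phi t.
  move=> t01; rewrite !fctE hdy1// hdy2//.
  (* The two equations, each valid almost everywhere, are combined under the integral. *)
  have -> : primitive phi t = primitive (fun s => 1 * ddy1 s + (-1) * ddy2 s) t.
    rewrite /primitive /Rintegral; congr fine.
    apply: ae_eq_integral => //.
    - by have /integrableP[] := integrable_subitv _ _ iphi t01.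
    - have [m1 _] := Lddy1; have [m2 _] := Lddy2.
      apply/measurable_EFinP.
      apply: (@measurable_funS _ _ _ _ `[(0:R), 1]) => //.
        move=> s /=; rewrite !in_itv/= => /andP[->] /le_trans; apply.
        by case/andP: t01.
      by apply: measurable_funD; apply: measurable_funM => //; exact: measurable_cst.
    - apply: (@filterS2 _ _ (ae_filter_ringOfSetsType leb) _ _ _ _ E1 E2)
        => s e1 e2 /=; rewrite in_itv/= => /andP[s0 st].
      have s01 : 0 <= s <= 1 by case/andP: t01 => _ t1; rewrite s0 (le_trans st).
      by rewrite e1 ?in_itv// e2 ?in_itv// /phi clamp_id//; congr EFin; ring.
  by rewrite primitive_lincomb// /primitive; ring.
have hz (y dy : R -> R) (t : R) : H1_01 y dy -> {within `[0, 1], continuous dy} ->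
    0 < t < 1 -> is_derive t 1 y (dy t).
  move=> [_ [Ldy hy]] cdy t01.
  exact: (primitive_shift_is_derive y dy t (L2_01_integrable _ Ldy) hy t01
    (within_continuous_interior _ _ cdy t01)).
have C2z : C2_01 (y1 - y2) (dy1 - dy2) phi.
  split; [exact: within_continuousB|exact: within_continuousB| |].
  - by move=> t t01; apply: is_deriveB; exact: hz.
  - by move=> t t01; exact: (primitive_shift_is_derive _ _ t iphi hdz t01 (cphi t)).
move=> t t01; rewrite -subr_le0 -[leRHS](mul0r (weight l t)).
apply: (comparison l 0 _ _ _ lpi _ C2z) => //.
- by rewrite !fctE y10 y20 subrr.
- by rewrite !fctE y11 y21 subrr.
- move=> s s01; rewrite mul0r !fctE subr_gt0 /phi => lt21.
  have s01' : 0 <= s <= 1 by case/andP: s01 => *; rewrite !ltW.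
  by rewrite !clamp_id//; exact: hf.
Qed.

Lemma mean_value_increment (f fx : R -> R -> R) (t x y : R) :
  t \in `[0, 1] ->
  (forall t x : R, t \in `[0, 1] -> is_derive x 1 (f t) (fx t x)) ->
  x <= y -> exists2 c, x <= c <= y & f t y - f t x = fx t c * (y - x).
Proof.
move=> t01 hfx xy.
have df s : s \in `]x, y[ -> is_derive s 1 (f t) (fx t s) by move=> _; exact: hfx.
have cf : {within `[x, y], continuous (f t)}.
  apply: continuous_subspaceT => s; apply: differentiable_continuous.
  by apply/derivable1_diffP; have [] := hfx t s t01.
have [c cxy fE] := MVT_segment xy df cf.
by exists c.
Qed.

(** The bound [K] satisfies [K cos(l/2) (l^2 - A) = C]. Hence [u > K w] forces [(l^2 - A) u > C], so
    [u'' >= - A u - C > - l^2 u] and the maximum principle applies. The same holds for [- u]. *)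
Lemma C2_01_bound (l A C : R) (u du ddu : R -> R) : 0 < l < pi -> A < l ^+ 2 -> 0 <= C ->
  C2_01 u du ddu -> u 0 = 0 -> u 1 = 0 ->
  (forall t, 0 < t < 1 -> `|ddu t| <= A * `|u t| + C) ->
  forall t, 0 <= t <= 1 -> `|u t| <= C / ((l ^+ 2 - A) * cos (l / 2)).
Proof.
move=> lpi Al C0 Hu u0 u1 Hdd t t01.
have cos0 := cos_half_gt0 _ lpi.
have lA : 0 < l ^+ 2 - A by rewrite subr_gt0.
pose K := C / ((l ^+ 2 - A) * cos (l / 2)).
have K0 : 0 <= K by rewrite divr_ge0// mulr_ge0// ltW.
have KE : K * cos (l / 2) * (l ^+ 2 - A) = C.
  by rewrite /K; field; rewrite !gt_eqF.
have half (z dz ddz : R -> R) : C2_01 z dz ddz -> z 0 = 0 -> z 1 = 0 ->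
    (forall s, 0 < s < 1 -> `|ddz s| <= A * `|z s| + C) -> z t <= K.
  move=> Hz z0 z1 Hddz.
  have wK : K * weight l t <= K by rewrite ler_piMr// weight_le1.
  apply: le_trans wK; apply: (comparison l K z dz ddz) => //; rewrite ?z0 ?z1//.
  move=> s s01; have s01' : 0 <= s <= 1 by case/andP: s01 => *; rewrite !ltW.
  have := ler_wpM2l K0 (weight_ge l s lpi s01') => h1 h2.
  have zs0 : 0 < z s.
    by apply: le_lt_trans (le_lt_trans h1 h2); rewrite mulr_ge0// ltW.
  have := Hddz s s01; rewrite (gtr0_norm zs0) ler_norml => /andP[h3 _].
  have h4 : C < z s * (l ^+ 2 - A) by rewrite -KE ltr_pM2r// (le_lt_trans h1).
  lra.
rewrite ler_norml lerNl; apply/andP; split; last exact: half Hu u0 u1 Hdd.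
have -> : - u t = ((-1) \*: u) t by rewrite /= scaleN1r.
apply: half (C2_01Z (-1) _ _ _ Hu) _ _ _; rewrite /= ?u0 ?u1 ?scaler0// => s s01.
by rewrite !scaleN1r !normrN; exact: Hdd.
Qed.

Lemma norm_clamp_le (K x : R) : 0 <= K -> `|clamp (- K) K x| <= `|x|.
Proof.
move=> K0; have KK : - K <= K by lra.
have [x0|x0] := lerP 0 x.
- have := clamp_sub (- K) K _ _ x0; rewrite [clamp _ _ 0]clamp_id; last lra.
  by move=> /andP[h1 h2]; rewrite !ger0_norm; lra.
- have := clamp_sub (- K) K _ _ (ltW x0); rewrite [clamp _ _ 0]clamp_id; last lra.
  by move=> /andP[h1 h2]; rewrite !ler0_norm; lra.
Qed.

(** Integrate [v] twice from 0, then subtract the linear function with the same value at 1. *)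
Lemma L2_01_double_primitive (v : R -> R) : L2_01 v ->
  exists W dW : R -> R, [/\ H1_01 W dW, H1_01 dW v, W 0 = 0 & W 1 = 0].
Proof.
move=> Lv; pose V := primitive v; pose c := primitive V 1.
have HV : H1_01 V v by exact: H1_01_primitive.
have LV : L2_01 V by case: HV.
exists (fun t => 1 * primitive V t + - c * t), (fun t => 1 * V t + - c * 1); split.
- exact: H1_01_lincomb (H1_01_primitive _ LV) (@H1_01_id R).
- have := H1_01_lincomb 1 (- c) _ _ _ _ HV (@H1_01_cst R 1).
  by congr H1_01; apply/funext => t /=; rewrite mul1r mulr0 addr0.
- by rewrite primitive0; ring.
- by rewrite -/c; ring.
Qed.

(** Clamping shrinks increments, possibly to 0, so slope bounds survive it when [m <= 0 <= M]; only
    slopes on [[-K, K]] enter. *)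
Lemma truncated_increment (f fx : R -> R -> R) (K t m M x y : R) : 0 <= K -> m <= 0 -> 0 <= M ->
  t \in `[0, 1] ->
  (forall t x : R, t \in `[0, 1] -> is_derive x 1 (f t) (fx t x)) ->
  (forall z, - K <= z <= K -> m <= fx t z <= M) -> x <= y ->
  m * (y - x) <= f t (clamp (- K) K y) - f t (clamp (- K) K x) <= M * (y - x).
Proof.
move=> K0 m0 M0 t01 hfx hb xy.
have KK : - K <= K by lra.
have /andP[d0 d1] := clamp_sub (- K) K _ _ xy.
have [z /andP[z1 z2] ->] := mean_value_increment f fx t _ _ t01 hfx
  (ltac:(by rewrite -subr_ge0) : clamp (- K) K x <= clamp (- K) K y).
have /andP[x1 _] := clamp_itv _ _ x KK; have /andP[_ y2] := clamp_itv _ _ y KK.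
have /andP[h1 h2] := hb z (ltac:(by rewrite (le_trans x1) ?(le_trans z2))).
apply/andP; split.
- apply: (@le_trans _ _ (m * (clamp (- K) K y - clamp (- K) K x))).
    by rewrite ler_wnM2l.
  by rewrite ler_wpM2r.
- apply: (@le_trans _ _ (M * (clamp (- K) K y - clamp (- K) K x))).
    by rewrite ler_wpM2r.
  by rewrite ler_wpM2l.
Qed.

Lemma dirichlet_solution_exists (f fx : R -> R -> R) (v : R -> R) (A B l m : R) :
  L2_01 v ->
  {within [set p : R * R | p.1 \in `[(0:R), 1]], continuous (fun p => f p.1 p.2)} ->
  (forall t x : R, t \in `[(0:R), 1] -> is_derive x (1:R) (f t) (fx t x)) ->
  {within [set p : R * R | p.1 \in `[(0:R), 1]], continuous (fun p => fx p.1 p.2)} ->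
  0 <= A -> 0 <= B -> 0 < l < pi -> A < l ^+ 2 -> - l ^+ 2 < m ->
  (forall t x : R, t \in `[(0:R), 1] -> `|f t x| <= A * `|x| + B) ->
  (forall t x : R, t \in `[(0:R), 1] -> m <= fx t x) ->
  exists x, dirichlet_solution f v x.
Proof.
move=> Lv cf hfx cfx A0 B0 lpi Al ml hAB hm.
have [W [dW [HW HdW W0 W1]]] := L2_01_double_primitive _ Lv.
have cW := H1_01_continuous _ _ HW.
have cnW : {within `[0, 1], continuous (fun t => `|W t|)}.
  by move=> t; apply: cvg_norm; exact: cW.
have [t0 _ Wmax] := EVT_max ler01 cnW.
pose Wm := `|W t0|; pose C := A * Wm + B.
have Wm0 : 0 <= Wm by exact: normr_ge0.
have C0 : 0 <= C by rewrite addr_ge0// mulr_ge0.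
pose K1 := C / ((l ^+ 2 - A) * cos (l / 2)).
have cos0 := cos_half_gt0 _ lpi.
have K10 : 0 <= K1 by rewrite divr_ge0// mulr_ge0// ?subr_ge0 ltW.
(* [K1] will bound [u] and [Wm] bounds [W], so [K] bounds [u + W]. *)
pose K := K1 + Wm; have K0 : 0 <= K by rewrite addr_ge0.
(* No global upper bound on [fx] is assumed; truncation leaves a compact rectangle, where continuity
   gives one. *)
have [M M0 hM] : exists2 M, 0 < M & forall t x, 0 <= t <= 1 -> - K <= x <= K -> fx t x <= M.
  have [|||c _ hc] := compact_EVT_max (T := (R * R)%type)
    (f := fun p => fx p.1 p.2) (A := `[0, 1] `*` `[- K, K]).
  - by exists (0, 0); split; rewrite /= in_itv/=; lra.
  - by apply: compact_setX; exact: segment_compact.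
  - by apply: continuous_subspaceW cfx => p [].
  exists (Num.max 1 (fx c.1 c.2)); first by rewrite lt_max ltr01.
  move=> t x t01 xK; rewrite le_max; apply/orP; right.
  by apply: (hc (t, x)); rewrite inE; split; rewrite /= in_itv.
have c01 (t : R) : clamp 0 1 t \in `[0, 1] by rewrite in_itv/= clamp_itv.
pose F t x := f (clamp 0 1 t) (clamp (- K) K (x + W (clamp 0 1 t))).
have cF u : continuous u -> continuous (fun t => F t (u t)).
  move=> cu; pose p (t : R) := (clamp 0 1 t, clamp (- K) K (u t + W (clamp 0 1 t))).
  have cx : continuous (fun t => clamp (- K) K (u t + W (clamp 0 1 t))).
    move=> t; apply: (@continuous_comp _ _ _ (fun t => u t + W (clamp 0 1 t)) (clamp (- K) K)).
      by apply: cvgD; [exact: cu|exact: (within_continuous_clamp _ _ _ ler01 cW)].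
    exact: clamp_continuous.
  have cp : continuous p.
    by move=> t; exact: (cvg_pair (clamp_continuous 0 1 t) (cx t)).
  exact: (within_continuous_in _ _ _ _ _ p cf cp).
(* The truncated function is constant in [x] beyond the clamp, so its lower slope bound cannot be
   positive. *)
pose m' := Num.min m 0.
have m'0 : m' <= 0 by rewrite ge_min lexx orbT.
have [|||u [du [Hu u0 u1]]] := semilinear_dirichlet_solvable l m' M F lpi M0 _ _ cF.
- rewrite lt_min ml/= oppr_lt0 exprn_gt0//; lra.
- lra.
- move=> t x y xy.
  have := @truncated_increment f fx K (clamp 0 1 t) m' M (x + W (clamp 0 1 t)) (y + W (clamp 0 1 t))
    K0 m'0 (ltW M0) (c01 t) hfx.
  rewrite lerD2r; have -> : y + W (clamp 0 1 t) - (x + W (clamp 0 1 t)) = y - x by ring.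
  apply => // z zK.
  rewrite hM// ?clamp_itv// andbT; apply: le_trans (hm _ z (c01 t)).
  by rewrite ge_min lexx.
(* Since clamping does not increase absolute values, [F] inherits the growth bound [A |u| + C]. The
   resulting estimate makes the truncation inactive along [u + W]. *)
have ub t : 0 <= t <= 1 -> `|u t| <= K1.
  apply: (C2_01_bound l A C _ _ _ lpi Al C0 Hu u0 u1) => s s01.
  have s01' : s \in `[0, 1] by rewrite in_itv/=; case/andP: s01 => *; rewrite !ltW.
  rewrite /F clamp_id -?in_itv//; apply: le_trans (hAB _ _ s01') _.
  rewrite /C addrA lerD2r -mulrDr ler_wpM2l//.
  apply: le_trans (norm_clamp_le _ _ K0) _.
  by apply: le_trans (ler_normD _ _) _; rewrite lerD2l Wmax.
have [cu cdu hu hdu] := Hu.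
have cg : continuous (fun t => F t (u (clamp 0 1 t))).
  exact: (cF (u \o clamp 0 1) (within_continuous_clamp _ _ _ ler01 cu)).
have Hux : H1_01 u du by exact: H1_01_intro.
have Hdu : H1_01 du (fun t => F t (u (clamp 0 1 t))).
  apply: H1_01_intro => //; first exact: continuous_subspaceT.
  by move=> t t01; rewrite clamp_id; [exact: hdu|case/andP: t01 => *; rewrite !ltW].
exists (fun t => 1 * u t + 1 * W t).
exists (fun t => 1 * du t + 1 * dW t), (fun t => 1 * F t (u (clamp 0 1 t)) + 1 * v t).
split; rewrite ?u0 ?u1 ?W0 ?W1 ?mulr0 ?addr0//; try exact: H1_01_lincomb.
apply: aeW => t t01; have t01' : 0 <= t <= 1 by move: t01; rewrite in_itv.
rewrite !mul1r /F clamp_id// clamp_id// -ler_norml.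
by apply: le_trans (ler_normD _ _) _; rewrite lerD ?ub ?Wmax.
Qed.

End DirichletProblem.

Theorem theorem3 (R : realType) (v : R -> R) (f fx : R -> R -> R) :
  L2_01 v ->
  (* C(c) *)
  {within [set p : R * R | p.1 \in `[(0:R), 1]], continuous (fun p => f p.1 p.2)} ->
  (forall t x : R, t \in `[(0:R), 1] -> is_derive x (1:R) (f t) (fx t x)) ->
  {within [set p : R * R | p.1 \in `[(0:R), 1]], continuous (fun p => fx p.1 p.2)} ->
  (* C(f) *)
  (exists A B : R, [/\ 0 < A, 0 < B, A < pi ^+ 2 &
     forall t x : R, t \in `[(0:R), 1] -> `|f t x| <= A * `|x| + B]) ->
  (* C(f_x) : inf f_x > - pi^2 *)
  (exists m : R, - pi ^+ 2 < m /\
     forall t x : R, t \in `[(0:R), 1] -> m <= fx t x) ->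
  exists x : R -> R, dirichlet_solution f v x /\
    forall y : R -> R, dirichlet_solution f v y ->
      forall t, t \in `[(0:R), 1] -> y t = x t.
Proof.
move=> Lv cf hfx cfx [A [B [A0 B0 Api hAB]]] [m [mpi hm]].
(* One frequency serves both purposes: [A < l^2] for the a priori bound, [- l^2 < m] for contraction
   and uniqueness. *)
have [|l [lpi]] := @exists_frequency R (Num.max A (- m)).
  by rewrite le_max (ltW A0)/= gt_max Api ltrNl.
rewrite gt_max => /andP[Al]; rewrite ltrNl => ml.
have [x Hx] := dirichlet_solution_exists _ _ _ _ _ _ _ Lv cf hfx cfx
  (ltW A0) (ltW B0) lpi Al ml hAB hm.
exists x; split=> // y Hy t; rewrite in_itv/= => t01.
have inc (s a b : R) : 0 <= s <= 1 -> a < b -> - l ^+ 2 * (b - a) < f s b - f s a.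
  move=> s01 ab; have s01' : s \in `[0, 1] by rewrite in_itv.
  have [c _ ->] := mean_value_increment f fx s a b s01' hfx (ltW ab).
  by rewrite ltr_pM2r ?subr_gt0// (lt_le_trans ml)// hm.
(* The comparison is used in both directions. *)
by apply: le_anti; rewrite !(dirichlet_solution_le f v _ _ l lpi cf inc)//.
Qed.
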